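(* In the setting and under the regularity assumption of the context, let $f(x,\mathbb Q)=\mathbb E_{z\sim\mathbb Q}[\ell(x,z)]$. Let $T\ge1$, $\delta\ge0$, and let sequences $x_1,\dots,x_T\in\mathcal X$ and $\mathbb Q_1,\dots,\mathbb Q_T\in\mathcal P$ be generated by the Distributional Best-Response algorithm (starting from $x_1\in\mathcal X$; for $t=1,\dots,T$, a worst-case expectation oracle returns $\mathbb Q_t$ given $x_t$, and then $x_{t+1}=\mathcal A(x_t,f(\cdot,\mathbb Q_t))\in\mathcal X$ for an online algorithm $\mathcal A$), with output $\bar x_T=\frac1T\sum_{t=1}^Tx_t$ and $\bar{\mathbb Q}_T=\frac1T\sum_{t=1}^T\mathbb Q_t$. Assume: (a) (worst-case expectation oracle) for every $t$, $\mathbb Q_t\in\mathcal P$ and $\mathbb E_{z\sim\mathbb Q_t}[\ell(x_t,z)]\ge\max_{\mathbb Q\in\mathcal P}\mathbb E_{z\sim\mathbb Q}[\ell(x_t,z)]-\delta$; (b) (no-regret guarantee) there is a bound $\mathcal R_T=o(T)$ such that $\sum_{t=1}^Tf(x_t,\mathbb Q_t)-\min_{x\in\mathcal X}\sum_{t=1}^Tf(x,\mathbb Q_t)\le\mathcal R_T$. Then $(\bar x_T,\bar{\mathbb Q}_T)\in\mathcal X\times\mathcal P$ and $$\mathrm{Gap}(\bar x_T,\bar{\mathbb Q}_T):=\max_{\mathbb Q\in\mathcal P}f(\bar x_T,\mathbb Q)-\min_{x\in\mathcal X}f(x,\bar{\mathbb Q}_T)\le\frac{\mathcal R_T}{T}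+\delta.$$
   Context: Notation: $[n]=\{1,\dots,n\}$; $\mathcal P(\mathcal Z)$ is the set of Borel probability measures on $\mathcal Z$. Setting. $\mathcal X\subseteq\mathbb R^n$, $\mathcal Z\subseteq\mathbb R^m$. A transportation cost $c:\mathcal Z\times\mathcal Z\to\mathbb R_+$ is lower semicontinuous, satisfies $c(z,z)=0$ for all $z$, and $c(\cdot,\hat z)$ is convex for every fixed $\hat z\in\mathcal Z$. The optimal transport discrepancy is $\mathrm{OT}_c(\mathbb P,\mathbb Q)=\min_{\gamma}\mathbb E_{(z,\hat z)\sim\gamma}[c(z,\hat z)]$ over couplings $\gamma$ of $\mathbb P$ and $\mathbb Q$. Given $\hat z_1,\dots,\hat z_N\in\mathcal Z$, let $\hat{\mathbb P}=\frac1N\sum_{i=1}^N\delta_{\hat z_i}$; given $\rho>0$, let $\mathcal P=\{\mathbb P\in\mathcal P(\mathcal Z):\mathrm{OT}_c(\mathbb P,\hat{\mathbb P})\le\rho\}$. Regularity assumption. (i) $\mathcal X$ is nonempty and convex; there exist $\mathbb Q_0\in\mathcal P$ and $x_0\in\mathcal X$ such that $x\mapsto\mathbb E_{z\sim\mathbb Q_0}[\ell(x,z)]$ is inf-compact on $\mathcal X$ (all sublevel sets are compact) and $\mathbb E_{z\sim\mathbb Q_0}[\ell(x_0,z)]>-\infty$; $\mathcal Z$ is nonempty, closed and convex. (ii) $\ell(x,z)=\max_{k\in[K]}\ell_k(x,z)$ with $K\ge2$, where each $\ell_k:\mathbb R^n\times\mathbb R^m\to\mathbb R$ is real-valued, convex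 in its first and concave in its second argument. (iii) There exist a norm $\|\cdot\|$ on $\mathbb R^m$ and $p\ge1$ with $c(z,\hat z)\ge\|z-\hat z\|^p$ for all $z,\hat z\in\mathcal Z$; moreover, if $p=1$, then for every $x\in\mathcal X$ there exist $g>0$, $\hat z_0\in\mathcal Z$ and $r\in[0,1)$ such that $\ell(x,z)\le g[1+\|z-\hat z_0\|^r]$ for all $z\in\mathcal Z$. *)

(* Defs.v *)
From HB Require Import structures.
From mathcomp Require Import all_boot all_order all_algebra.
From mathcomp Require Import all_classical all_reals all_analysis.

Set Implicit Arguments.
Unset Strict Implicit.
Unset Printing Implicit Defensive.

Import Order.TTheory GRing.Theory Num.Theory.
Import numFieldNormedType.Exports.

Local Open Scope classical_set_scope.
Local Open Scope ring_scope.

(* R^m with its Borel sigma-algebra. Probability measures on a closed set Z are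
   encoded as Borel measures on R^m of mass 1 that are concentrated on Z. *)
Definition borelRV (R : realType) (m : nat) :=
  g_sigma_algebraType (@open 'rV[R]_m).

Definition borel_measure (R : realType) (m : nat) :=
  {measure set (borelRV R m) -> \bar R}.

Section setting.
Context {R : realType} {n m : nat}.

Definition is_norm (nrm : 'rV[R]_m -> R) : Prop :=
  [/\ forall u v, nrm (u + v) <= nrm u + nrm v,
      forall (a : R) u, nrm (a *: u) = `|a| * nrm u &
      forall u, nrm u = 0 -> u = 0].

(* The values of c outside Z x Z are irrelevant: lower semicontinuity is taken
   in the topology of the subspace Z x Z, in which the points outside Z x Z are
   isolated. *)
Record transport_cost (Z : set 'rV[R]_m) (c : 'rV[R]_m -> 'rV[R]_m -> R) :
    Prop := {
  cost_ge0 : forall z zh, Z z -> Z zh -> 0 <= c z zh ;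
  cost_lsc : lower_semicontinuous
    (fun w : subspace (Z `*` Z) => (c w.1 w.2)%:E) ;
  cost_diag : forall z, Z z -> c z z = 0 ;
  cost_convex : forall zh, Z zh -> convex_function Z (fun z => c z zh) }.

Definition prob_on (Z : set 'rV[R]_m) : set (borel_measure R m) :=
  [set P | P [set: borelRV R m] = 1%E /\ P Z = 1%E].

Definition coupling (P Q : borel_measure R m) :
    set {measure set (borelRV R m * borelRV R m) -> \bar R} :=
  [set gam | (forall A : set (borelRV R m),
                measurable A -> gam (A `*` setT) = P A) /\
             (forall A : set (borelRV R m),
                measurable A -> gam (setT `*` A) = Q A)].

Definition OT (Z : set 'rV[R]_m) (c : 'rV[R]_m -> 'rV[R]_m -> R)
    (P Q : borel_measure R m) : \bar R :=
  ereal_inf [set \int[gam]_(w in Z `*` Z) (c w.1 w.2)%:E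
            | gam in coupling P Q]%E.

Definition avg_measure (N : nat) (Q : nat -> borel_measure R m) :
    borel_measure R m :=
  mscale (N%:R^-1)%:nng (msum Q N).

Definition empirical (N : nat) (zhat : nat -> 'rV[R]_m) : borel_measure R m :=
  avg_measure N (fun i => dirac (zhat i : borelRV R m)).

Definition ambiguity_set (Z : set 'rV[R]_m) (c : 'rV[R]_m -> 'rV[R]_m -> R)
    (N : nat) (zhat : nat -> 'rV[R]_m) (rho : R) : set (borel_measure R m) :=
  [set P | prob_on Z P /\ (OT Z c P (empirical N zhat) <= rho%:E)%E].

(* Extended-real valued; +oo + -oo is -oo by the library convention. *)
Definition expected_loss (ell : 'rV[R]_n -> 'rV[R]_m -> R) (x : 'rV[R]_n)
    (Q : borel_measure R m) : \bar R :=
  (\int[Q]_z (ell x z)%:E)%E.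

Definition inf_compact_on (X : set 'rV[R]_n) (F : 'rV[R]_n -> \bar R) : Prop :=
  forall a : R, compact [set x | X x /\ (F x <= a%:E)%E].

Record regularity (X : set 'rV[R]_n) (Z : set 'rV[R]_m)
    (c : 'rV[R]_m -> 'rV[R]_m -> R) (PP : set (borel_measure R m))
    (K : nat) (ell_ : 'I_K -> 'rV[R]_n -> 'rV[R]_m -> R)
    (ell : 'rV[R]_n -> 'rV[R]_m -> R) : Prop := {
  reg_X0 : X !=set0 ;
  reg_Xconvex : convex_set X ;
  reg_infcompact : exists Q0 x0,
    [/\ PP Q0, X x0, inf_compact_on X (expected_loss ell ^~ Q0) &
        (-oo < expected_loss ell x0 Q0)%E] ;
  reg_Z0 : Z !=set0 ;
  reg_Zclosed : closed Z ;
  reg_Zconvex : convex_set Z ;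
  reg_K : (2 <= K)%N ;
  reg_max : forall x z,
    (ell x z)%:E = \big[Order.max/-oo%E]_(k < K) (ell_ k x z)%:E ;
  reg_convex : forall k z, convex_function setT (fun x => ell_ k x z) ;
  reg_concave : forall k x, convex_function setT (fun z => - ell_ k x z) ;
  reg_growth : exists (nrm : 'rV[R]_m -> R) (p : R),
    [/\ is_norm nrm, 1 <= p,
        forall z zh, Z z -> Z zh -> nrm (z - zh) `^ p <= c z zh &
        p = 1 -> forall x, X x -> exists (g : R) (z0 : 'rV[R]_m) (r : R),
          [/\ 0 < g, Z z0, 0 <= r < 1 &
              forall z, Z z -> ell x z <= g * (1 + nrm (z - z0) `^ r)]] }.

Definition worst_case (PP : set (borel_measure R m))
    (ell : 'rV[R]_n -> 'rV[R]_m -> R) (x : 'rV[R]_n) : \bar R :=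
  ereal_sup [set expected_loss ell x Q | Q in PP].

Definition oracle_answer (PP : set (borel_measure R m))
    (ell : 'rV[R]_n -> 'rV[R]_m -> R) (delta : R) (x : 'rV[R]_n)
    (Q : borel_measure R m) : Prop :=
  PP Q /\ (worst_case PP ell x - delta%:E <= expected_loss ell x Q)%E.

(* Iterates are numbered from 0: x t and Q t are the (t+1)-st iterates. Only
   the terms with t < T, and x T, are constrained. *)
Record DBR_run (X : set 'rV[R]_n) (PP : set (borel_measure R m))
    (ell : 'rV[R]_n -> 'rV[R]_m -> R) (delta : R)
    (A : 'rV[R]_n -> ('rV[R]_n -> \bar R) -> 'rV[R]_n) (T : nat)
    (x : nat -> 'rV[R]_n) (Q : nat -> borel_measure R m) : Prop := {
  run_init : X (x 0%N) ;
  run_oracle : forall t, (t < T)%N -> oracle_answer PP ell delta (x t) (Q t) ;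
  run_update : forall t, (t < T)%N ->
    x t.+1 = A (x t) (expected_loss ell ^~ (Q t)) /\ X (x t.+1) }.

Definition regret (X : set 'rV[R]_n) (ell : 'rV[R]_n -> 'rV[R]_m -> R)
    (T : nat) (x : nat -> 'rV[R]_n) (Q : nat -> borel_measure R m) : \bar R :=
  (\sum_(t < T) expected_loss ell (x t) (Q t)
   - ereal_inf [set \sum_(t < T) expected_loss ell y (Q t) | y in X])%E.

Definition gap (X : set 'rV[R]_n) (PP : set (borel_measure R m))
    (ell : 'rV[R]_n -> 'rV[R]_m -> R) (x : 'rV[R]_n) (Q : borel_measure R m) :
    \bar R :=
  (worst_case PP ell x - ereal_inf [set expected_loss ell y Q | y in X])%E.

Definition avg_point (T : nat) (x : nat -> 'rV[R]_n) : 'rV[R]_n :=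
  T%:R^-1 *: \sum_(t < T) x t.

End setting.

(* Main.v *)
Require Import Defs.
From HB Require Import structures.
From mathcomp Require Import all_boot all_order all_algebra.
From mathcomp Require Import all_classical all_reals all_analysis.
From mathcomp Require Import measurable_realfun lra.
Import Order.TTheory GRing.Theory Num.Theory.
Import numFieldNormedType.Exports.
Local Open Scope classical_set_scope.
Local Open Scope ring_scope.

Set Implicit Arguments.
Unset Strict Implicit.
Unset Printing Implicit Defensive.

(* Write f(x, Q) for the expected loss. Convexity of f(., Q) and linearity of
   f(x, .) give
     max f(xbar, .) <= (1/T) sum_t max f(x_t, .)
                    <= (1/T) sum_t f(x_t, Q_t) + delta,
     min f(., Qbar) = (1/T) min_x sum_t f(x, Q_t),
   and the difference of the right-hand sides is regret / T + delta. Averaging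
   transport plans shows that the ambiguity set is convex.

   Expected losses may be -oo, so convexity of f(., Q) rests on additivity of
   the integral for functions whose positive part is integrable. The loss is
   such a function: a concave function on R^m grows at most linearly and all
   norms on R^m are equivalent, so the loss is at most D (1 + c(z, zhat_i)),
   and weak Kantorovich duality bounds its integral by the transport
   discrepancy. *)

Section convexity.
Context {R : numFieldType}.
Implicit Type V : lmodType R.

Lemma convex_setP V (X : set V) : convex_set X <->
  forall (s : R) u v, 0 <= s <= 1 -> X u -> X v -> X (s *: u + (1 - s) *: v).
Proof.
split=> [cX s u v /andP[s0 s1] Xu Xv|cX u v s /[!inE] Xu Xv].
  by have := cX u v (Itv01 s0 s1); rewrite !inE => /(_ Xu Xv).
by apply: cX => //; rewrite ge0 le1.
Qed.

Lemma convex_functionP V (f : V -> R) : convex_function [set: V] f <->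
  forall (s : R) u v, 0 <= s <= 1 ->
    f (s *: u + (1 - s) *: v) <= s * f u + (1 - s) * f v.
Proof.
split=> [cf s u v /andP[s0 s1]|cf s u v _ _].
  by have := cf (Itv01 s0 s1) u v; rewrite !inE => /(_ I I).
by apply: cf; rewrite ge0 le1.
Qed.

Lemma convex_set_sum V (X : set V) T (w : 'I_T -> R) (u : 'I_T -> V) :
  convex_set X -> (forall t, 0 <= w t) -> \sum_t w t = 1 ->
  (forall t, X (u t)) -> X (\sum_t w t *: u t).
Proof.
move=> cX; elim: T w u => [|T IH] w u w0.
  by rewrite big_ord0 => /eqP; rewrite eq_sym oner_eq0.
rewrite !big_ord_recl /=; set s := w ord0; set ws := \sum_(t < T) _ => sw Xu.
have ws0 : 0 <= ws by exact: sumr_ge0.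
have wsE : ws = 1 - s by rewrite -sw addrC addKr.
have [ws_eq0|ws_neq0] := eqVneq ws 0.
  have s1 : s = 1 by rewrite -sw ws_eq0 addr0.
  rewrite s1 scale1r big1 ?addr0 // => t _.
  by rewrite (psumr_eq0P _ ws_eq0) ?scale0r.
have -> : \sum_(t < T) w (lift ord0 t) *: u (lift ord0 t) =
    (1 - s) *: \sum_(t < T) (w (lift ord0 t) / ws) *: u (lift ord0 t).
  rewrite scaler_sumr; apply: eq_bigr => t _.
  by rewrite scalerA -wsE mulrC divfK.
apply: (iffLR (convex_setP X)) => //; first by rewrite /s w0 -subr_ge0 -wsE.
apply: IH => [t||t]; [by rewrite divr_ge0| |exact: Xu].
by rewrite -mulr_suml divff.
Qed.

Lemma convex_set_epigraph V (f : V -> R) : convex_function [set: V] f ->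
  convex_set [set z : V * R^o | f z.1 <= z.2].
Proof.
move=> /convex_functionP cf; apply/convex_setP => s u v s01 /= fu fv.
apply: (le_trans (cf _ _ _ s01)); case/andP: s01 => s0 s1.
by rewrite lerD// ler_wpM2l// subr_ge0.
Qed.

(* Jensen's inequality, read off the epigraph. *)
Lemma convex_function_sum V (f : V -> R) T (w : 'I_T -> R) (u : 'I_T -> V) :
  convex_function [set: V] f -> (forall t, 0 <= w t) -> \sum_t w t = 1 ->
  f (\sum_t w t *: u t) <= \sum_t w t * f (u t).
Proof.
move=> /convex_set_epigraph epi w0 w1.
have := convex_set_sum (u := fun t => (u t, f (u t) : R^o)) epi w0 w1.
by rewrite /= !raddf_sum; apply.
Qed.

Lemma sum_inv_card T : (0 < T)%N -> \sum_(t < T) T%:R^-1 = 1 :> R.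
Proof.
move=> T0; rewrite sumr_const card_ord -[LHS]mulr_natl mulfV//.
by rewrite pnatr_eq0 -lt0n.
Qed.

Lemma convex_set_avg V (X : set V) T (u : 'I_T -> V) :
  convex_set X -> (0 < T)%N -> (forall t, X (u t)) ->
  X (T%:R^-1 *: \sum_t u t).
Proof.
by move=> cX T0 Xu; rewrite scaler_sumr; apply: convex_set_sum => //;
  exact: sum_inv_card.
Qed.

Lemma convex_function_avg V (f : V -> R) T (u : 'I_T -> V) :
  convex_function [set: V] f -> (0 < T)%N ->
  f (T%:R^-1 *: \sum_t u t) <= T%:R^-1 * \sum_t f (u t).
Proof.
move=> cf T0; rewrite scaler_sumr mulr_sumr; apply: convex_function_sum => //.
exact: sum_inv_card.
Qed.

End convexity.

Section convex_function_segment.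
Context {R : realFieldType} {V : lmodType R} (f : V -> R).
Hypothesis cf : convex_function [set: V] f.

Lemma convex_function_ray z v s : 0 <= s <= 1 ->
  f (z + s *: v) <= f z + s * (f (z + v) - f z).
Proof.
move=> s01; have -> : z + s *: v = s *: (z + v) + (1 - s) *: z.
  by rewrite scalerDr scalerBl scale1r [RHS]addrC addrA subrK.
by apply: (le_trans (iffLR (convex_functionP f) cf _ _ _ s01)); lra.
Qed.

Lemma convex_function_segment z v s : `|s| <= 1 ->
  f (z + s *: v) <= f z + `|s| * (`|f (z + v) - f z| + `|f (z - v) - f z|).
Proof.
case: ger0P => [s0 s1|/ltW s0 s1].
  apply: (le_trans (convex_function_ray _ _ _)); first by rewrite s0.
  by rewrite lerD2l ler_wpM2l// (le_trans (ler_norm _))// lerDl.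
rewrite -[s in leLHS]opprK scaleNr -scalerN.
apply: (le_trans (convex_function_ray _ _ _)); first by rewrite oppr_ge0 s0.
by rewrite lerD2l ler_wpM2l ?oppr_ge0// (le_trans (ler_norm _))// lerDr.
Qed.

Lemma convex_function_midpoint z h : 2 * f z <= f (z + h) + f (z - h).
Proof.
have half : 0 <= (2^-1 : R) <= 1 by lra.
have := convex_function_ray (z + h) (- (h + h)) half.
have -> : z + h + - (h + h) = z - h by rewrite opprD addrA addrK.
have -> : z + h + 2^-1 *: - (h + h) = z.
  rewrite -mulr2n scalerN -[h *+ 2]scaler_nat scalerA mulVf ?pnatr_eq0//.
  by rewrite scale1r addrK.
by lra.
Qed.

End convex_function_segment.

Section convex_function_rV.
Context {R : realType}.

Lemma ler_coord_norm m (h : 'rV[R]_m) j : `|h 0 j| <= `|h|.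
Proof.
rewrite [leRHS](_ : _ = mx_norm h)// mx_normrE.
by apply/bigmax_geP; right; exists (0, j).
Qed.

Lemma add_avg_axes m (z h : 'rV[R]_m.+1) :
  z + h = m.+1%:R^-1 *: \sum_j (z + h 0 j *: (m.+1%:R *: 'e_j)).
Proof.
have m0 : m.+1%:R != 0 :> R by rewrite pnatr_eq0.
rewrite big_split/= sumr_const card_ord -[z *+ _]scaler_nat.
under eq_bigr do rewrite scalerA mulrC -scalerA.
by rewrite -scaler_sumr -row_sum_delta -scalerDr scalerA mulVf// scale1r.
Qed.

(* By [add_avg_axes] a displacement is an average of displacements along the
   axes, where one-variable convexity applies. *)
Lemma convex_upper_lipschitz m (f : 'rV[R]_m -> R) z :
  convex_function [set: 'rV[R]_m] f -> exists2 B : R, 0 <= B &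
  forall h, `|h| <= 1 -> f (z + h) <= f z + B * `|h|.
Proof.
case: m f z => [|m] f z cf.
  by exists 0 => // h _; rewrite (thinmx0 h) addr0 mul0r addr0.
pose e j : 'rV[R]_m.+1 := m.+1%:R *: 'e_j.
pose b j := `|f (z + e j) - f z| + `|f (z - e j) - f z|.
have b0 j : 0 <= b j by rewrite addr_ge0.
exists (\sum_j b j); first exact: sumr_ge0.
move=> h h1; rewrite add_avg_axes.
apply: (le_trans (convex_function_avg _ cf _)) => //.
have axis_le j : f (z + h 0 j *: e j) <= f z + `|h| * b j.
  have hj := ler_coord_norm h j.
  apply: (le_trans (convex_function_segment cf _ _ (le_trans hj h1))).
  by rewrite lerD2l ler_wpM2r.
have m_ge0 : 0 <= m.+1%:R^-1 :> R by rewrite invr_ge0.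
apply: (le_trans (ler_wpM2l m_ge0 (ler_sum _ (fun j _ => axis_le j)))).
rewrite big_split /= sumr_const card_ord -[f z *+ _]mulr_natl -mulr_sumr mulrDr.
rewrite mulrA mulVf ?pnatr_eq0// mul1r lerD2l [leRHS]mulrC.
by rewrite ler_piMl ?mulr_ge0 ?sumr_ge0// invf_le1// ler1n.
Qed.

Lemma convex_lower_lipschitz m (f : 'rV[R]_m -> R) z :
  convex_function [set: 'rV[R]_m] f ->
  exists2 B : R, 0 <= B & forall h, f z - B * `|h| <= f (z + h).
Proof.
move=> cf; have [B B0 fB] := convex_upper_lipschitz z cf; exists B => //.
have unit_ball h : `|h| <= 1 -> f z - B * `|h| <= f (z + h).
  move=> h1; have := fB (- h); rewrite normrN => /(_ h1).
  by have := convex_function_midpoint cf z h; lra.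
move=> h; have [/unit_ball//|h1] := leP `|h| 1.
have h0 : 0 < `|h| by apply: lt_trans h1.
have s01 : 0 <= `|h|^-1 <= 1 by rewrite invr_ge0 (ltW h0)/= invf_le1// ltW.
have := convex_function_ray cf z h s01.
have := unit_ball (`|h|^-1 *: h); rewrite normrZ gtr0_norm ?invr_gt0//.
rewrite mulVf ?gt_eqF// lexx => /(_ isT) /le_trans /[apply].
by rewrite mulr1 lerD2l -(ler_pM2l h0) mulrA mulfV ?gt_eqF// mul1r; lra.
Qed.

Lemma convex_continuous m (f : 'rV[R]_m -> R) :
  convex_function [set: 'rV[R]_m] f -> continuous f.
Proof.
move=> cf z; have [B B0 fB] := convex_upper_lipschitz z cf.
have [B' B'0 fB'] := convex_lower_lipschitz z cf.
have lipschitz v : `|z - v| <= 1 -> `|f z - f v| <= (B + B') * `|z - v|.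
  rewrite distrC => zv; have := fB' (v - z); have := fB _ zv.
  rewrite subrKC ler_norml => ub lb.
  have := mulr_ge0 B0 (normr_ge0 (v - z)).
  by have := mulr_ge0 B'0 (normr_ge0 (v - z)); lra.
apply/(@cvgrPdist_le _ _ _ (nbhs z)) => e e0.
have BB' : 0 < B + B' + 1 by rewrite ltr_wpDl// addr_ge0.
near=> v; apply: (le_trans (lipschitz v _)).
  by near: v; apply: cvgr_dist_le => //; exact: cvg_id.
rewrite (@le_trans _ _ ((B + B' + 1) * `|z - v|))//.
  by rewrite ler_wpM2r// lerDl.
rewrite -ler_pdivlMl// mulrC; near: v; apply: cvgr_dist_le; first exact: cvg_id.
exact: divr_gt0.
Unshelve. all: by end_near. Qed.

End convex_function_rV.

Section is_norm.
Context {R : realType} {m : nat} (nrm : 'rV[R]_m -> R).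
Hypothesis nrmP : is_norm nrm.

Lemma is_norm_ge0 u : 0 <= nrm u.
Proof.
case: nrmP => nD nZ _; have := nD u (- u).
rewrite subrr -(scaleN1r u) nZ -[X in nrm X](scale0r 0) nZ normr0 mul0r normrN1.
by lra.
Qed.

Lemma is_norm_convex : convex_function [set: 'rV[R]_m] nrm.
Proof.
case: nrmP => nD nZ _; apply/convex_functionP => s u v /andP[s0 s1].
by apply: (le_trans (nD _ _)); rewrite !nZ !ger0_norm// subr_ge0.
Qed.

(* The unit sphere is compact, so [nrm] attains a positive minimum on it. *)
Lemma is_norm_dominates : exists2 k : R, 0 <= k & forall u, `|u| <= k * nrm u.
Proof.
have [nD nZ nrm_eq0] := nrmP.
pose S : set 'rV[R]_m := [set u | `|u| = 1].
have unitS u : u != 0 -> S (`|u|^-1 *: u).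
  by move=> u0; rewrite /S /= normrZ normfV normr_id mulVf ?normr_eq0.
have [S0|/set0P/negP] := pselect (S !=set0); last first.
  rewrite negbK => /eqP S0; exists 0 => // u.
  have [->|/unitS] := eqVneq u 0; first by rewrite normr0 mul0r.
  by rewrite S0.
have cS : compact S.
  apply: bounded_closed_compact.
    by exists 1; split => // x x1 u; rewrite /S /= => ->; exact: ltW.
  have -> : S = (@Num.norm R _) @^-1` [set 1] by [].
  by apply: closed_comp => // u _; exact: norm_continuous.
have [v /[!inE] Sv vmin] := compact_EVT_min S0 cS
  (continuous_subspaceT (convex_continuous is_norm_convex)).
have nv : 0 < nrm v.
  rewrite lt_neqAle is_norm_ge0 andbT eq_sym; apply/eqP => /nrm_eq0 v0.
  by move: Sv; rewrite /S /= v0 normr0 => /eqP; rewrite eq_sym oner_eq0.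
exists (nrm v)^-1; first by rewrite invr_ge0 ltW.
move=> u; have [->|u0] := eqVneq u 0.
  by rewrite normr0 mulr_ge0 ?is_norm_ge0// invr_ge0 ltW.
have := vmin (`|u|^-1 *: u); rewrite inE nZ normfV normr_id.
move=> /(_ (unitS _ u0)).
by rewrite ler_pdivlMl ?normr_gt0// ler_pdivlMl// mulrC.
Qed.

End is_norm.

Section integral_monotone.
Local Open Scope ereal_scope.
Context {d : measure_display} {U : measurableType d} {R : realType}.
Import HBNNSimple.
Implicit Types (mu : {measure set U -> \bar R}) (D E : set U).

(* The integral of a nonnegative function is a supremum over the simple
   functions below it, so no measurability is needed here. *)
Lemma ge0_le_integral_subset mu D E (f g : U -> \bar R) : D `<=` E ->
  (forall x, D x -> 0 <= f x) -> (forall x, E x -> 0 <= g x) ->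
  (forall x, D x -> f x <= g x) ->
  \int[mu]_(x in D) f x <= \int[mu]_(x in E) g x.
Proof.
move=> DE f0 g0 fg; rewrite !ge0_integralE//.
apply: ereal_sup_le => _ [h /= hf <-].
exists h => // x /=; apply: (le_trans (hf x)).
rewrite !patchE; case: ifPn => [/[!inE] Dx|_].
  by rewrite mem_set; [exact: fg|exact: DE].
by case: ifPn => // /[!inE] /g0.
Qed.

Lemma le_integral_pointwise mu D (f g : U -> \bar R) :
  (forall x, D x -> f x <= g x) ->
  \int[mu]_(x in D) f x <= \int[mu]_(x in D) g x.
Proof.
move=> fg; have fgD : {in D, forall x, f x <= g x} by move=> x /[!inE] /fg.
rewrite [leLHS]integralE [leRHS]integralE.
apply: leeB; apply: ge0_le_integral_subset => // x /mem_set Dx.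
- exact: funepos_le fgD _ Dx.
- exact: funeneg_le fgD _ Dx.
Qed.

Lemma ge0_integral_mscale_msum_le (k : {nonneg R})
    (mu : {measure set U -> \bar R}^nat) N D (f : U -> \bar R) :
  (forall x, D x -> 0 <= f x) ->
  \int[mscale k (msum mu N)]_(x in D) f x <=
  k%:num%:E * \sum_(i < N) \int[mu i]_(x in D) f x.
Proof.
move=> f0; rewrite [leLHS]ge0_integralE//.
apply: ge_ereal_sup => _ [h /= hf <-].
have h0 x : 0 <= (h x)%:E by rewrite lee_fin.
have mh : measurable_fun setT (EFin \o h) by exact/measurable_EFinP.
rewrite -integralT_nnsfun ge0_integral_mscale// ge0_integral_measure_sum//.
rewrite lee_wpmul2l ?lee_fin//; apply: lee_sum => i _.
rewrite integralT_nnsfun ge0_integralE//.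
by apply: ereal_sup_ubound; exists h.
Qed.

Lemma pmuleDr (k : R) (x y : \bar R) : (0 < k)%R ->
  k%:E * (x + y) = k%:E * x + k%:E * y.
Proof.
move=> k0; have [xy|] := boolP (x +? y); first exact: muleDr.
by case: x y => [x||] [y||]//= _; rewrite gt0_muleNy ?gt0_muley ?lte_fin.
Qed.

Lemma integral_mscale_msum (k : {nonneg R}) (mu : {measure set U -> \bar R}^nat)
    N D (f : U -> \bar R) :
  measurable D -> (0 < k%:num)%R -> measurable_fun D f ->
  \int[mscale k (msum mu N)]_(x in D) f x =
  k%:num%:E * \sum_(i < N) \int[mu i]_(x in D) f x.
Proof.
move=> mD k0 mf; rewrite integralE.
have mpos := measurable_funepos mf; have mneg := measurable_funeneg mf.
rewrite !ge0_integral_mscale// !ge0_integral_measure_sum//.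
rewrite -muleN -pmuleDr//; congr (_ * _).
under [RHS]eq_bigr do rewrite integralE.
rewrite [RHS]big_split/= sumeN//.
by move=> i j _ _; rewrite ge0_adde_def// inE integral_ge0.
Qed.

End integral_monotone.

Section funepos.
Local Open Scope ereal_scope.
Context {U : Type} {R : realDomainType}.
Implicit Types f g : U -> \bar R.

Lemma funeposD_le f g x : (f \+ g)^\+ x <= f^\+ x + g^\+ x.
Proof.
rewrite !funeposE ge_max adde_ge0 ?le_max ?lexx ?orbT// andbT.
by rewrite leeD// le_max lexx.
Qed.

Lemma funeneg_leD f g x : f^\- x <= (f \+ g)^\- x + g^\+ x.
Proof.
rewrite funeposE !funenegE ge_max adde_ge0 ?le_max ?lexx ?orbT// andbT /=.
case: (f x) (g x) => [a||] [b||]//=;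
  rewrite ?leNye ?maxye ?maxNye ?adde0 ?add0e -?EFin_max ?addye ?leey//.
rewrite -EFinD lee_fin.
by have [?|?] := leP (- (a + b))%R 0%R; have [?|?] := leP b 0%R; lra.
Qed.

End funepos.

Section upper_integrable.
Local Open Scope ereal_scope.
Context {d : measure_display} {U : measurableType d} {R : realType}.
Context (mu : {measure set U -> \bar R}) (D : set U).
Hypothesis mD : measurable D.
Implicit Types f g : U -> \bar R.

Definition upper_integrable f : Prop :=
  measurable_fun D f /\ \int[mu]_(x in D) f^\+ x < +oo.

Lemma upper_integrable0 : upper_integrable (cst 0).
Proof.
split; first exact: measurable_cst.
by rewrite integral0_eq// => x _; rewrite funeposE maxxx.
Qed.

Lemma upper_integrableD f g :
  upper_integrable f -> upper_integrable g -> upper_integrable (f \+ g).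
Proof.
move=> [mf f_lty] [mg g_lty]; split; first exact: emeasurable_funD.
apply: (@le_lt_trans _ _ (\int[mu]_(x in D) (f^\+ x + g^\+ x))).
  by apply: le_integral_pointwise => x _; exact: funeposD_le.
rewrite ge0_integralD//; [exact: lte_add_pinfty|
  exact: measurable_funepos|exact: measurable_funepos].
Qed.

Lemma upper_integrable_integrable f : upper_integrable f ->
  \int[mu]_(x in D) f^\- x < +oo -> mu.-integrable D f.
Proof.
move=> [mf f_lty] fneg_lty; apply/integrableP; split=> //.
rewrite -[fun x => _]/(abse \o f) fune_abse ge0_integralD//;
  [exact: lte_add_pinfty|exact: measurable_funepos|exact: measurable_funeneg].
Qed.

Lemma integral_eqNy f :
  \int[mu]_(x in D) f^\- x = +oo -> \int[mu]_(x in D) f x = -oo.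
Proof. by move=> fnegE; rewrite integralE fnegE addeNy. Qed.

Lemma upper_integralD_Ny f g : upper_integrable f -> upper_integrable g ->
  \int[mu]_(x in D) f^\- x = +oo -> \int[mu]_(x in D) (f x + g x) = -oo.
Proof.
move=> uf ug fnegE; apply: integral_eqNy.
have [[mf _] [mg g_lty]] := (uf, ug).
have : \int[mu]_(x in D) f^\- x <=
    \int[mu]_(x in D) (f \+ g)^\- x + \int[mu]_(x in D) g^\+ x.
  rewrite -ge0_integralD//.
  - by apply: le_integral_pointwise => x _; exact: funeneg_leD.
  - by apply: measurable_funeneg; exact: emeasurable_funD.
  - exact: measurable_funepos.
rewrite fnegE leye_eq.
by case: (\int[mu]_(x in D) g^\+ x) g_lty => // r; case: integral.
Qed.

Lemma upper_integralD f g : upper_integrable f -> upper_integrable g ->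
  \int[mu]_(x in D) (f x + g x) =
  \int[mu]_(x in D) f x + \int[mu]_(x in D) g x.
Proof.
move=> uf ug.
have [fneg_lty|] := ltP (\int[mu]_(x in D) f^\- x) +oo; last first.
  rewrite leye_eq => /eqP fnegE.
  by rewrite upper_integralD_Ny// (integral_eqNy fnegE) addNye.
have [gneg_lty|] := ltP (\int[mu]_(x in D) g^\- x) +oo; last first.
  rewrite leye_eq => /eqP gnegE; rewrite (integral_eqNy gnegE) addeNy.
  by under eq_integral do rewrite addeC; rewrite upper_integralD_Ny.
by rewrite integralD//; exact: upper_integrable_integrable.
Qed.

Lemma upper_integrable_sum I (s : seq I) (f : I -> U -> \bar R) :
  (forall i, upper_integrable (f i)) ->
  upper_integrable (fun x => \sum_(i <- s) f i x).
Proof.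
move=> uf; elim: s => [|i s IH].
  by under eq_fun do rewrite big_nil; exact: upper_integrable0.
by under eq_fun do rewrite big_cons; exact: upper_integrableD.
Qed.

Lemma upper_integral_sum I (s : seq I) (f : I -> U -> \bar R) :
  (forall i, upper_integrable (f i)) ->
  \int[mu]_(x in D) (\sum_(i <- s) f i x) =
  \sum_(i <- s) \int[mu]_(x in D) f i x.
Proof.
move=> uf; elim: s => [|i s IH].
  by under eq_integral do rewrite big_nil; rewrite integral0 big_nil.
under eq_integral do rewrite big_cons.
by rewrite upper_integralD ?IH ?big_cons//; exact: upper_integrable_sum.
Qed.

Lemma integralZl_gt0 (k : R) f : (0 < k)%R -> measurable_fun D f ->
  \int[mu]_(x in D) (k%:E * f x) = k%:E * \int[mu]_(x in D) f x.
Proof.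
move=> k0 mf; have k_ge0 := ltW k0.
rewrite integralE [in RHS]integralE pmuleDr// muleN.
rewrite ge0_funeposM// ge0_funenegM//.
by rewrite !ge0_integralZl_EFin//; [exact: measurable_funeneg|
  exact: measurable_funepos].
Qed.

End upper_integrable.

Lemma emeasurable_bigmax d (U : measurableType d) (R : realType) (D : set U) I
    (s : seq I) (f : I -> U -> \bar R) :
  measurable D -> (forall i, measurable_fun D (f i)) ->
  measurable_fun D (fun z => \big[Order.max/-oo%E]_(i <- s) f i z).
Proof.
move=> mD mf; elim: s => [|i s IH].
  by under eq_fun do rewrite big_nil; exact: measurable_cst.
by under eq_fun do rewrite big_cons; exact: measurable_maxe.
Qed.

Section borel.
Context {R : realType} {m : nat}.

Lemma open_borel (A : set 'rV[R]_m) :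
  open A -> measurable (A : set (borelRV R m)).
Proof. exact: sub_sigma_algebra. Qed.

Lemma closed_borel (A : set 'rV[R]_m) :
  closed A -> measurable (A : set (borelRV R m)).
Proof.
move=> cA; rewrite -(setCK A); apply: measurableC; apply: open_borel.
exact: closed_openC.
Qed.

Lemma finite_borel (A : set 'rV[R]_m) :
  finite_set A -> measurable (A : set (borelRV R m)).
Proof.
move=> fA; apply: closed_borel; apply: (iffLR accessible_finite_set_closed) fA.
exact/hausdorff_accessible/norm_hausdorff.
Qed.

Lemma continuous_borel (f : 'rV[R]_m -> R) :
  continuous f -> measurable_fun setT (f : borelRV R m -> R).
Proof.
move=> cf; apply: (measurability _ (RGenOInfty.measurableE R)).
move=> /= _ [_ [a ->]] <-; apply: measurableI => //.
apply: open_borel; apply: open_comp => [z _|]; first exact: cf.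
exact: interval_open.
Qed.

Lemma prob_onC (Z : set 'rV[R]_m) (P : borel_measure R m) :
  measurable (Z : set (borelRV R m)) -> prob_on Z P -> P (~` Z) = 0%E.
Proof.
move=> mZ [PT PZ]; have PE : (1 = P (~` Z) + 1)%E.
  rewrite -{1}PT -PZ (_ : [set: borelRV R m] = ~` Z `|` Z); last first.
    by rewrite setUC setUv.
  exact: (measureU P (measurableC mZ) mZ (setICl Z)).
by rewrite -[LHS](@addeK _ 1%E)// -PE subee.
Qed.

End borel.

Section average.
Local Open Scope ereal_scope.
Context {R : realType}.

Lemma avge_const T (a : \bar R) : (0 < T)%N ->
  (T%:R^-1)%:E * \sum_(t < T) a = a.
Proof.
move=> T0; rewrite sumr_const card_ord (_ : (a *+ T)%R = T%:R%:E * a).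
  by rewrite muleA -EFinM mulVf ?mul1e// pnatr_eq0 -lt0n.
by rewrite mule_natl.
Qed.

Lemma avge_le T (F : nat -> \bar R) a : (0 < T)%N ->
  (forall t, (t < T)%N -> F t <= a) -> (T%:R^-1)%:E * \sum_(t < T) F t <= a.
Proof.
move=> T0 Fa; rewrite -[leRHS](avge_const _ T0).
by rewrite lee_wpmul2l ?lee_fin ?invr_ge0//; apply: lee_sum => t _; exact: Fa.
Qed.

Context {m : nat}.
Implicit Types P Q : nat -> borel_measure R m.

Lemma avg_measure_eq T (a : \bar R) Q (B : set (borelRV R m)) : (0 < T)%N ->
  (forall t, (t < T)%N -> Q t B = a) -> avg_measure T Q B = a.
Proof.
move=> T0 Qa; rewrite -[RHS](avge_const _ T0).
by congr (_ * _); apply: eq_bigr => t _; exact: Qa.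
Qed.

Lemma avg_measure_const T (P : borel_measure R m) :
  (0 < T)%N -> avg_measure T (fun=> P) = P.
Proof.
by move=> T0; apply: eq_measure; apply/funext => B; exact: avg_measure_eq.
Qed.

Lemma prob_on_avg (Z : set 'rV[R]_m) T Q :
  (0 < T)%N -> (forall t, (t < T)%N -> prob_on Z (Q t)) ->
  prob_on Z (avg_measure T Q).
Proof. by move=> T0 QZ; split; apply: avg_measure_eq => // t /QZ[]. Qed.

Lemma empiricalC N (zhat : nat -> 'rV[R]_m) : (0 < N)%N ->
  empirical N zhat (~` (zhat @` `I_N)) = 0.
Proof.
move=> N0; apply: avg_measure_eq => // i iN.
by rewrite /= diracE memNset//; apply; exists i.
Qed.

End average.

Section coupling.
Local Open Scope ereal_scope.
Context {R : realType} {m : nat}.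
Local Notation E := (borelRV R m).
Implicit Types P Q : borel_measure R m.
Implicit Types gam : {measure set (E * E) -> \bar R}.

Definition avg_plan T (gam : nat -> {measure set (E * E) -> \bar R}) :
    {measure set (E * E) -> \bar R} :=
  mscale (T%:R^-1)%:nng%R (msum gam T).

Lemma coupling_avg T (P Q : nat -> borel_measure R m)
    (gam : nat -> {measure set (E * E) -> \bar R}) :
  (forall t, (t < T)%N -> coupling (P t) (Q t) (gam t)) ->
  coupling (avg_measure T P) (avg_measure T Q) (avg_plan T gam).
Proof.
move=> gamPQ; split=> A mA; rewrite /avg_measure /mscale/= /mscale /msum/=;
  congr (_ * _); apply: eq_bigr => t _.
  by case: (gamPQ t (ltn_ord t)) => ->.
by case: (gamPQ t (ltn_ord t)) => _ ->.
Qed.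

Lemma coupling_setXC P Q gam (A B : set E) :
  coupling P Q gam -> measurable A -> measurable B ->
  P (~` A) = 0 -> Q (~` B) = 0 -> gam (~` (A `*` B)) = 0.
Proof.
move=> [gamP gamQ] /measurableC mA /measurableC mB PA QB.
have -> : ~` (A `*` B) = (~` A `*` setT) `|` (setT `*` ~` B).
  by apply/seteqP; split=> [w /not_andP[?|?]|w [[? _]|[_ ?]] []//];
    [left|right].
rewrite measureU0 ?gamP ?gamQ//; exact: measurableX.
Qed.

Lemma integral_fst_coupling P Q gam (h : E -> \bar R) : coupling P Q gam ->
  measurable_fun setT h -> (forall z, 0 <= h z) ->
  \int[P]_z h z = \int[gam]_w h w.1.
Proof.
move=> [gamP _] mh h0; have mfst := @measurable_fst _ _ E E.
have := ge0_integral_pushforward mfst gam measurableT mh (fun z _ => h0 z).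
rewrite preimage_setT => <-.
pose fst_mfun : {mfun (E * E)%type >-> E} :=
  HB.pack (@fst E E) (isMeasurableFun.Build _ _ _ _ _ mfst).
apply: (@eq_measure_integral _ _ _ _ (pushforward gam fst_mfun)) => A mA _.
by rewrite -gamP//=; congr (gam _); apply/seteqP; split => [w []|w].
Qed.

End coupling.

Section optimal_transport.
Local Open Scope ereal_scope.
Context {R : realType} {m : nat}.
Local Notation E := (borelRV R m).
Context (Z : set 'rV[R]_m) (c : 'rV[R]_m -> 'rV[R]_m -> R).
Hypothesis cost : transport_cost Z c.
Implicit Types P Q : borel_measure R m.

Let cost_pos (w : E * E) : (Z `*` Z) w -> 0 <= (c w.1 w.2)%:E.
Proof. by move=> [? ?]; rewrite lee_fin; exact: (cost_ge0 cost). Qed.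

Lemma OT_ge0 P Q : 0 <= OT Z c P Q.
Proof.
apply: le_ereal_inf_tmp => _ [gam _ <-].
exact: (integral_ge0 _ cost_pos).
Qed.

Lemma OT_avg_measure T (P Q : nat -> borel_measure R m) : (0 < T)%N ->
  OT Z c (avg_measure T P) (avg_measure T Q) <=
  (T%:R^-1)%:E * \sum_(t < T) OT Z c (P t) (Q t).
Proof.
move=> T0; have T_gt0 : (0 < T%:R^-1 :> R)%R by rewrite invr_gt0 ltr0n.
pose OTt (t : nat) := OT Z c (P t) (Q t).
have [OT_fin|/existsNP[t]] := pselect (forall t : 'I_T, OTt t \is a fin_num);
    last first.
  move/negP; rewrite ge0_fin_numE ?OT_ge0// -leNgt leye_eq => /eqP OTt_y.
  have -> : \sum_(t < T) OTt t = +oo.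
    apply/esum_eqyP; last by exists t; split; rewrite ?mem_index_enum.
    by move=> i _; rewrite gt_eqF// (lt_le_trans _ (OT_ge0 _ _)).
  by rewrite gt0_muley ?leey ?lte_fin.
apply/lee_addgt0Pr => e e0.
have /choice[gam gamP] (t : nat) : exists gam, (t < T)%N ->
    coupling (P t) (Q t) gam /\
    \int[gam]_(w in Z `*` Z) (c w.1 w.2)%:E <= OTt t + e%:E.
  have [tT|Tt] := ltnP t T; last by exists mzero.
  by have [_ [gam ? <-] /ltW] := lb_ereal_inf_adherent e0 (OT_fin (Ordinal tT));
    exists gam.
have OT_le : OT Z c (avg_measure T P) (avg_measure T Q) <=
    \int[avg_plan T gam]_(w in Z `*` Z) (c w.1 w.2)%:E.
  apply: ereal_inf_lbound; exists (avg_plan T gam) => //.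
  by apply: coupling_avg => t /gamP[].
apply: (le_trans OT_le).
apply: (le_trans (ge0_integral_mscale_msum_le _ _ _ cost_pos)).
rewrite -[e%:E](avge_const _ T0) -pmuleDr// -big_split/=.
rewrite lee_wpmul2l ?lee_fin ?(ltW T_gt0)//; apply: lee_sum => t _.
by case: (gamP t (ltn_ord t)).
Qed.

(* Weak Kantorovich duality for the dual pair [(h, 0)]. *)
Lemma integral_le_OT P Q (F : set E) (h : E -> \bar R) :
  measurable (Z : set E) -> measurable F -> F `<=` Z ->
  prob_on Z P -> Q (~` F) = 0 ->
  measurable_fun setT h -> (forall z, 0 <= h z) ->
  (forall z zh, Z z -> F zh -> h z <= (c z zh)%:E) ->
  \int[P]_z h z <= OT Z c P Q.
Proof.
move=> mZ mF FZ PZ QF mh h0 hc; apply: le_ereal_inf_tmp => _ [gam gamPQ <-].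
have gamC := coupling_setXC gamPQ mZ mF (prob_onC mZ PZ) QF.
rewrite (integral_fst_coupling gamPQ)//.
rewrite (ge0_negligible_integral _ _ _ _ gamC)//.
- rewrite setTD setCK; apply: ge0_le_integral_subset => //.
  + by move=> w [? /FZ].
  + by move=> w [? ?]; exact: hc.
- by apply: measurableC; exact: measurableX.
- exact: (measurableT_comp mh (@measurable_fst _ _ E E)).
Qed.

(* Since [c] need not be measurable, it is [max (g / D - 1) 0] that is
   integrated and compared with [c] on [Z `*` F]. *)
Lemma upper_integrable_OT P Q (F : set E) (g : E -> R) (D : R) :
  measurable (Z : set E) -> measurable F -> F `<=` Z ->
  prob_on Z P -> Q (~` F) = 0 -> OT Z c P Q < +oo ->
  measurable_fun setT g -> (0 < D)%R ->
  (forall z zh, Z z -> F zh -> g z <= D * (1 + c z zh))%R ->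
  upper_integrable P setT (EFin \o g).
Proof.
move=> mZ mF FZ PZ QF OT_lty mg D0 gc; split; first exact/measurable_EFinP.
pose h z : R := Num.max (g z / D - 1)%R 0%R.
have h0 z : 0 <= (h z)%:E by rewrite lee_fin le_max lexx orbT.
have mh : measurable_fun setT (EFin \o h).
  apply/measurable_EFinP/measurable_maxr => //.
  by apply: measurable_funB => //; exact: measurable_funM.
have h_lty : \int[P]_z (h z)%:E < +oo.
  apply: le_lt_trans OT_lty; apply: (integral_le_OT mZ mF FZ PZ QF mh) => //.
  move=> z zh Zz Fz; have Zzh := FZ _ Fz.
  rewrite lee_fin ge_max (cost_ge0 cost)// andbT.
  by rewrite lerBlDl ler_pdivrMr// mulrC gc.
apply: (@le_lt_trans _ _ (\int[P]_z (D%:E * (1 + (h z)%:E)))).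
  apply: le_integral_pointwise => z _; have := h0 z; rewrite lee_fin => hz0.
  rewrite funeposE /= -EFin_max lee_fin ge_max mulr_ge0 ?addr_ge0 ?(ltW D0)//.
  by rewrite andbT mulrC -ler_pdivrMr// -lerBlDl le_max lexx.
rewrite ge0_integralZl_EFin ?ltW//; last 2 first.
- by move=> z _; rewrite adde_ge0.
- exact: emeasurable_funD.
rewrite ge0_integralD// integral_cst// PZ.1 mule1.
by rewrite lte_mul_pinfty ?lee_fin ?ltW// lte_add_pinfty// ltry.
Qed.

End optimal_transport.

Section loss.
Context {R : realType} {n m K : nat}.
Context {X : set 'rV[R]_n} {Z : set 'rV[R]_m}.
Context {c : 'rV[R]_m -> 'rV[R]_m -> R} {PP : set (borel_measure R m)}.
Context {ell_ : 'I_K -> 'rV[R]_n -> 'rV[R]_m -> R}.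
Context {ell : 'rV[R]_n -> 'rV[R]_m -> R}.
Hypothesis cost : transport_cost Z c.
Hypothesis reg : regularity X Z c PP ell_ ell.

Lemma loss_ge k x z : ell_ k x z <= ell x z.
Proof. by rewrite -lee_fin (reg_max reg); exact: le_bigmax. Qed.

Lemma loss_attained x z : exists k, ell x z = ell_ k x z.
Proof.
have : ((ell x z)%:E <= \big[Order.max/-oo]_(k < K) (ell_ k x z)%:E)%E.
  by rewrite -(reg_max reg).
case/bigmax_geP => // -[k _]; rewrite lee_fin => le_k.
by exists k; apply/eqP; rewrite eq_le le_k loss_ge.
Qed.

Lemma loss_convex z : convex_function [set: 'rV[R]_n] (ell^~ z).
Proof.
move=> t u v uT vT; have [k ->] := loss_attained (conv t u v) z.
apply: (le_trans (reg_convex reg k z t uT vT)).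
by rewrite lerD// ler_wpM2l ?loss_ge// subr_ge0.
Qed.

Lemma loss_measurable x : measurable_fun setT (ell x : borelRV R m -> R).
Proof.
apply/measurable_EFinP.
rewrite (_ : EFin \o ell x =
    fun z => \big[Order.max/-oo%E]_(k < K) (ell_ k x z)%:E).
  apply: emeasurable_bigmax => // k; apply/measurable_EFinP.
  apply: continuous_borel => z; rewrite -[ell_ k x]opprK.
  exact/continuousN/(convex_continuous (reg_concave reg k x)).
by apply/funext => z /=; rewrite (reg_max reg).
Qed.

Lemma loss_le_norm x : exists2 B : R, 0 <= B &
  forall z, ell x z <= B * (1 + `|z|).
Proof.
have /choice[B BP] k : exists B, 0 <= B /\
    forall z, ell_ k x z <= ell_ k x 0 + B * `|z|.
  have [B B0 BP] := convex_lower_lipschitz 0 (reg_concave reg k x).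
  by exists B; split=> // z; have := BP z; rewrite add0r; lra.
have B0 k : 0 <= `|ell_ k x 0| + B k by rewrite addr_ge0// (BP k).1.
exists (\sum_k (`|ell_ k x 0| + B k)) => [|z]; first exact: sumr_ge0.
have [k ->] := loss_attained x z.
apply: (@le_trans _ _ ((`|ell_ k x 0| + B k) * (1 + `|z|))); last first.
  by rewrite ler_wpM2r ?addr_ge0// (bigD1 k)//= lerDl sumr_ge0.
apply: (le_trans ((BP k).2 z)).
rewrite mulrDl lerD// ?ler_wpM2l ?lerDr ?(BP k).1//.
by rewrite (le_trans (ler_norm _))// ler_peMr// lerDl.
Qed.

Lemma norm_le_cost zh : Z zh -> exists2 k : R, 0 <= k &
  forall z, Z z -> `|z| <= k * (1 + c z zh).
Proof.
move=> Zzh; have [nrm [p [nrmP p1 nrm_c _]]] := reg_growth reg.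
have [k k0 norm_nrm] := is_norm_dominates nrmP.
exists (`|zh| + k) => [|z Zz]; first by rewrite addr_ge0.
have nrm_le : nrm (z - zh) <= 1 + c z zh.
  apply: (@le_trans _ _ (1 + nrm (z - zh) `^ p)); last by rewrite lerD2l nrm_c.
  have [le1|/ltW ge1] := leP (nrm (z - zh)) 1.
    by rewrite (le_trans le1)// lerDl powR_ge0.
  by rewrite (le_trans (le1r_powR ge1 p1))// lerDr.
have c0 : 0 <= c z zh by exact: (cost_ge0 cost).
rewrite -[z in leLHS](subrK zh) addrC (le_trans (ler_normD _ _))// mulrDl.
rewrite lerD//; first by rewrite ler_peMr// lerDl.
by rewrite (le_trans (norm_nrm _))// ler_wpM2l.
Qed.

Lemma loss_le_cost N (zhat : nat -> 'rV[R]_m) x :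
  (forall i, (i < N)%N -> Z (zhat i)) ->
  exists2 D : R, 0 < D &
    forall z i, Z z -> (i < N)%N -> ell x z <= D * (1 + c z (zhat i)).
Proof.
move=> Zzhat; have [B B0 ellB] := loss_le_norm x.
have /choice[k kP] (i : 'I_N) : exists k, 0 <= k /\
    forall z, Z z -> `|z| <= k * (1 + c z (zhat i)).
  by have [k k0 kP] := norm_le_cost (Zzhat i (ltn_ord i)); exists k.
have k0 i : 0 <= k i by rewrite (kP i).1.
pose S := \sum_i k i; have S0 : 0 <= S by exact: sumr_ge0.
exists (B * (1 + S) + 1) => [|z i Zz iN].
  by rewrite ltr_wpDl// mulr_ge0// addr_ge0.
have c0 : 0 <= c z (zhat i) by apply: (cost_ge0 cost) => //; exact: Zzhat.
have z_le : `|z| <= S * (1 + c z (zhat i)).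
  apply: (le_trans ((kP (Ordinal iN)).2 z Zz)).
  rewrite ler_wpM2r ?addr_ge0// /S (bigD1 (Ordinal iN))//= lerDl.
  exact: sumr_ge0.
apply: (le_trans (ellB z)); rewrite mulrDl mul1r ler_wpDr ?addr_ge0//.
rewrite -mulrA ler_wpM2l// mulrDl mul1r lerD//.
by rewrite lerDl.
Qed.

End loss.

Section ambiguity_set.
Local Open Scope ereal_scope.
Context {R : realType} {m : nat}.
Context (Z : set 'rV[R]_m) (c : 'rV[R]_m -> 'rV[R]_m -> R).
Context (N : nat) (zhat : nat -> 'rV[R]_m) (rho : R).
Hypothesis cost : transport_cost Z c.

Lemma ambiguity_set_avg T (Q : nat -> borel_measure R m) : (0 < T)%N ->
  (forall t, (t < T)%N -> ambiguity_set Z c N zhat rho (Q t)) ->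
  ambiguity_set Z c N zhat rho (avg_measure T Q).
Proof.
move=> T0 PPQ; split; first by apply: prob_on_avg => // t /PPQ[].
rewrite -(avg_measure_const (empirical N zhat) T0).
apply: (le_trans (OT_avg_measure cost Q (fun=> empirical N zhat) T0)).
apply: (@avge_le _ _ (fun t => OT Z c (Q t) (empirical N zhat))) => // t.
by move/PPQ => [].
Qed.

Lemma upper_integrable_loss n K (X : set 'rV[R]_n)
    (ell_ : 'I_K -> 'rV[R]_n -> 'rV[R]_m -> R)
    (ell : 'rV[R]_n -> 'rV[R]_m -> R) x (Q : borel_measure R m) :
  (0 < N)%N -> (forall i, (i < N)%N -> Z (zhat i)) ->
  regularity X Z c (ambiguity_set Z c N zhat rho) ell_ ell ->
  ambiguity_set Z c N zhat rho Q ->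
  upper_integrable Q setT (EFin \o ell x).
Proof.
move=> N0 Zzhat reg [QZ Q_rho].
have [D D0 ellD] := loss_le_cost cost reg x Zzhat.
apply: (@upper_integrable_OT _ _ _ _ cost _ (empirical N zhat) (zhat @` `I_N)).
- exact: closed_borel (reg_Zclosed reg).
- exact: finite_borel (finite_image _ (finite_II N)).
- by move=> _ [i iN <-]; exact: Zzhat.
- exact: QZ.
- exact: empiricalC.
- by rewrite (le_lt_trans Q_rho) ?ltry.
- exact: loss_measurable reg x.
- exact: D0.
- by move=> z _ Zz [i iN <-]; exact: ellD.
Qed.

End ambiguity_set.

Section gap.
Local Open Scope ereal_scope.
Context {R : realType} {n m : nat}.
Context (PP : set (borel_measure R m)) (ell : 'rV[R]_n -> 'rV[R]_m -> R).
Hypothesis ell_convex : forall z, convex_function [set: 'rV[R]_n] (ell^~ z).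
Hypothesis ell_upper : forall y Q,
  PP Q -> upper_integrable Q setT (EFin \o ell y).
Context (T : nat).
Hypothesis T0 : (0 < T)%N.

Let T_gt0 : (0 < T%:R^-1 :> R)%R.
Proof. by rewrite invr_gt0 ltr0n. Qed.

Lemma expected_loss_avg_measure y (Q : nat -> borel_measure R m) :
  measurable_fun setT (EFin \o ell y : borelRV R m -> \bar R) ->
  expected_loss ell y (avg_measure T Q) =
  (T%:R^-1)%:E * \sum_(t < T) expected_loss ell y (Q t).
Proof. by move=> my; rewrite /expected_loss integral_mscale_msum. Qed.

Lemma expected_loss_avg_point (x : nat -> 'rV[R]_n) Q : PP Q ->
  expected_loss ell (avg_point T x) Q <=
  (T%:R^-1)%:E * \sum_(t < T) expected_loss ell (x t) Q.
Proof.
move=> PPQ; have loss_upper (t : 'I_T) := ell_upper (x t) PPQ.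
rewrite /expected_loss -upper_integral_sum// -integralZl_gt0//; last first.
  exact: (upper_integrable_sum measurableT (index_enum _) loss_upper).1.
apply: le_integral_pointwise => z _; rewrite sumEFin -EFinM lee_fin.
exact: convex_function_avg (ell_convex z) T0.
Qed.

Lemma worst_case_avg_point (x : nat -> 'rV[R]_n) :
  worst_case PP ell (avg_point T x) <=
  (T%:R^-1)%:E * \sum_(t < T) worst_case PP ell (x t).
Proof.
apply: ge_ereal_sup => _ [Q PPQ <-].
apply: (le_trans (expected_loss_avg_point _ PPQ)).
rewrite lee_pmul2l//; apply: lee_sum => t _.
by apply: ereal_sup_ubound; exists Q.
Qed.

Lemma ereal_inf_expected_loss_avg_measure (X : set 'rV[R]_n)
    (Q : nat -> borel_measure R m) : (forall t, (t < T)%N -> PP (Q t)) ->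
  ereal_inf [set expected_loss ell y (avg_measure T Q) | y in X] =
  (T%:R^-1)%:E *
    ereal_inf [set \sum_(t < T) expected_loss ell y (Q t) | y in X].
Proof.
move=> PPQ; rewrite -ereal_inf_pZl// image_comp; congr ereal_inf.
apply: eq_imagel => y _; apply: expected_loss_avg_measure.
by have [] := ell_upper y (PPQ 0%N T0).
Qed.

(* In the library's extended reals [-oo] absorbs under addition and positive
   factors distribute, so no finiteness is needed to rearrange the bound. *)
Lemma gap_le_regret X delta (x : nat -> 'rV[R]_n)
    (Q : nat -> borel_measure R m) :
  (forall t, (t < T)%N -> oracle_answer PP ell delta (x t) (Q t)) ->
  gap X PP ell (avg_point T x) (avg_measure T Q) <=
  (T%:R^-1)%:E * regret X ell T x Q + delta%:E.
Proof.
move=> oracle; have PPQ t : (t < T)%N -> PP (Q t) by case/oracle.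
rewrite /gap ereal_inf_expected_loss_avg_measure// -muleN /regret pmuleDr//.
rewrite addeAC; apply: leeD2r; apply: (le_trans (worst_case_avg_point x)).
rewrite -[delta%:E](avge_const _ T0) -pmuleDr// lee_pmul2l// -big_split.
apply: lee_sum => t _; rewrite -leeBlDr//.
by case: (oracle t (ltn_ord t)).
Qed.

End gap.

Lemma DBR_run_feasible (R : realType) (n m : nat) (X : set 'rV[R]_n)
    (PP : set (borel_measure R m)) (ell : 'rV[R]_n -> 'rV[R]_m -> R) (delta : R)
    (A : 'rV[R]_n -> ('rV[R]_n -> \bar R) -> 'rV[R]_n) (T : nat)
    (x : nat -> 'rV[R]_n) (Q : nat -> borel_measure R m) :
  DBR_run X PP ell delta A T x Q -> forall t, (t <= T)%N -> X (x t).
Proof.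
move=> run [_|t tT]; first exact: run_init run.
by case: (run_update run tT).
Qed.

Theorem theorem4 (R : realType) (n m : nat)
    (X : set 'rV[R]_n) (Z : set 'rV[R]_m)
    (c : 'rV[R]_m -> 'rV[R]_m -> R)
    (N : nat) (zhat : nat -> 'rV[R]_m) (rho : R)
    (K : nat) (ell_ : 'I_K -> 'rV[R]_n -> 'rV[R]_m -> R)
    (ell : 'rV[R]_n -> 'rV[R]_m -> R)
    (T : nat) (delta : R)
    (A : 'rV[R]_n -> ('rV[R]_n -> \bar R) -> 'rV[R]_n)
    (x : nat -> 'rV[R]_n) (Q : nat -> borel_measure R m)
    (Reg : nat -> R) :
  let PP := ambiguity_set Z c N zhat rho in
  transport_cost Z c ->
  (0 < N)%N ->
  (forall i, (i < N)%N -> Z (zhat i)) ->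
  0 < rho ->
  regularity X Z c PP ell_ ell ->
  (0 < T)%N ->
  0 <= delta ->
  DBR_run X PP ell delta A T x Q ->
  Reg =o_\oo (fun t : nat => t%:R : R) ->
  (regret X ell T x Q <= (Reg T)%:E)%E ->
  [/\ X (avg_point T x), PP (avg_measure T Q) &
      (gap X PP ell (avg_point T x) (avg_measure T Q)
         <= (Reg T / T%:R + delta)%:E)%E].
Proof.
move=> PP cost N0 Zzhat _ reg T0 _ run _ regret_le.
have oracle t (tT : (t < T)%N) := run_oracle run tT.
split.
- apply: (convex_set_avg (reg_Xconvex reg)) => // t.
  exact: DBR_run_feasible run _ (ltnW (ltn_ord t)).
- by apply: ambiguity_set_avg => // t /oracle[].
- have ell_convex := loss_convex reg.
  have ell_upper y Q' := upper_integrable_loss cost y (Q := Q') N0 Zzhat reg.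
  apply: (le_trans (gap_le_regret ell_convex ell_upper T0 X oracle)).
  rewrite EFinD; apply: leeD2r; rewrite mulrC EFinM lee_pmul2l//.
  by rewrite lte_fin invr_gt0 ltr0n.
Qed.
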